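(* Let $l \geq 1$ be an integer and write $l = \sum_{i=1}^{n} 2^{k_i}$ with integers $0 \leq k_1 < k_2 < \cdots < k_n$ (binary expansion). Then the reduction sequence of $l$ is \[ \Omega(l) = (k_1+1,\; k_2-k_1,\; \dots,\; k_n - k_{n-1}). \] Equivalently, $\Omega(l)$ equals the composition of $l$: reading the binary expansion of $l$ from right to left, the first part is the number of digits up to and including the first $1$, the second part is the number of additional digits up to and including the second $1$, and so on.
   Context: For integers $m \geq 1$ and $0 \leq l \leq m$ let $A_{l,m} = \frac{l!\, m!}{2^{m-l}} \sum_{k=l}^{m} 2^{k} \binom{2m-2k}{m-k}\binom{m+k}{m}\binom{k}{l}$ (integers; $A_{0,0}=1$), and let $\nu_2$ denote the $2$-adic valuation. For $l \geq 0$ let $X(l) = \big(\nu_2(A_{l,\,l+m-1})\big)_{m \geq 1}$. Operators on sequences: $F(a_1,a_2,a_3,\dots) = (a_1,a_1,a_2,a_3,\dots)$, $T(a_1,a_2,a_3,\dots) = (a_1,a_3,a_5,\dots)$. Let $c = (\nu_2(m))_{m\geq 1}$. For $s \geq 2$, a sequence $(a_j)_{j\geq1}$ is $s$-simple if $s$ is the largest integer with $a_{st+1} = \cdots = a_{s(t+1)}$ for all $t \geq 0$. Reduction algorithm: $X_1(l) = X(l)$; at cycle $k$, take $n_k$ with $X_k(l)$ $2^{n_k}$-simple, set $W = F(T^{n_k}(X_k(l)) - c)$ (termwise subtraction); if $W$ is constant stop, otherwise set $X_{k+1}(l) = W$ and continue. The number $\omega(l)$ of cycles performed is the reduction length, and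 $\Omega(l) = (n_1, n_2, \dots, n_{\omega(l)})$ is the reduction sequence of $l$. *)

(* Defs.v *)
From mathcomp Require Import all_boot all_order all_algebra.

Set Implicit Arguments.
Unset Strict Implicit.
Unset Printing Implicit Defensive.

Import Order.TTheory GRing.Theory Num.Theory.
Local Open Scope ring_scope.

(* The A l m are integers for l <= m, but this is a fact, not part of the
   formula; as elements of rat they need no exactness of the division. *)
Definition A (l m : nat) : rat :=
  (l`! * m`!)%N%:R / 2 ^+ (m - l) *
  (\sum_(l <= k < m.+1)
     2 ^ k * 'C(2 * m - 2 * k, m - k) * 'C(m + k, m) * 'C(k, l))%N%:R.

(* Only meaningful for q != 0: here nu2 0 = 0 because logn 2 0 = 0. *)
Definition nu2 (q : rat) : int :=
  (logn 2 `|numq q|)%:Z - (logn 2 `|denq q|)%:Z.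

(* A sequence (a_1, a_2, a_3, ...) is represented by the function
   j |-> a_(j+1); all indices below are shifted by one accordingly. *)
Definition sequence := nat -> int.

Definition X (l : nat) : sequence := fun j => nu2 (A l (l + j)).

Definition F (a : sequence) : sequence := fun j => a j.-1.

Definition T (a : sequence) : sequence := fun j => a (2 * j)%N.

Definition c : sequence := fun j => (logn 2 j.+1)%:Z.

Definition constant_blocks (s : nat) (a : sequence) : Prop :=
  forall t i : nat, (i < s)%N -> a (s * t + i)%N = a (s * t)%N.

Definition simple (s : nat) (a : sequence) : Prop :=
  [/\ (2 <= s)%N, constant_blocks s a &
      forall s' : nat, constant_blocks s' a -> (s' <= s)%N].

Definition constant_seq (a : sequence) : Prop :=
  exists v : int, forall j : nat, a j = v.

Definition W (n : nat) (a : sequence) : sequence :=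
  F (fun j => iter n T a j - c j).

(* reduction a ns: the algorithm started on a terminates, and the exponents
   n_1, n_2, ... of its successive cycles are the entries of ns. *)
Inductive reduction : sequence -> seq nat -> Prop :=
| reduction_stop (a : sequence) (n : nat) :
    simple (2 ^ n) a -> constant_seq (W n a) -> reduction a [:: n]
| reduction_next (a : sequence) (n : nat) (ns : seq nat) :
    simple (2 ^ n) a -> ~ constant_seq (W n a) -> reduction (W n a) ns ->
    reduction a (n :: ns).

Definition is_Omega (l : nat) (ns : seq nat) : Prop := reduction (X l) ns.

(* (k_1, ..., k_n) |-> (k_1 + 1, k_2 - k_1, ..., k_n - k_(n-1)) *)
Definition gaps (ks : seq nat) : seq nat :=
  if ks is k1 :: ks' then k1.+1 :: pairmap (fun k k' => k' - k)%N k1 ks'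
  else [::].

(* Least significant digit first; l > 0 has (trunc_log 2 l).+1 digits. *)
Definition binary_digits (l : nat) : bitseq :=
  [seq odd (l %/ 2 ^ i) | i <- iota 0 (trunc_log 2 l).+1].

(* d is the number of digits 0 read since the last digit 1. *)
Fixpoint read_digits (d : nat) (bs : bitseq) : seq nat :=
  match bs with
  | [::] => [::]
  | true :: bs' => d.+1 :: read_digits 0 bs'
  | false :: bs' => read_digits d.+1 bs'
  end.

Definition composition (l : nat) : seq nat := read_digits 0 (binary_digits l).

(* Main.v *)
Require Import Defs.
From mathcomp Require Import all_boot all_order all_algebra.
From mathcomp Require Import zify ring.

Set Implicit Arguments.
Unset Strict Implicit.
Unset Printing Implicit Defensive.
Import Order.TTheory GRing.Theory Num.Theory.

(** Up to the factor [l! m! / 2^(m-l)], [A l m] is the coefficient of [x^l] in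
    [P(x+1)], where [P = sum_k 2^k C(2m-2k,m-k) C(m+k,m) x^k].  The two-term
    recurrence of the coefficients of [P] is a second order differential
    equation, and translating it by 1 gives the recurrence
    [B(l-1) = (2m+1) B(l) - (m-l)(m+l+1) B(l+1)] for
    [B(l) = A l m / (2^l (m+1-l) ... (m+l))].  As [B(m) = 1], every [B(l)] is
    odd, so [X l j = l + v((j+1) ... (j+2l)) = 2l + f_l(j/2)], where
    [f_l(t) = v((t+1) ... (t+l))] is the 2-adic valuation [vrising l t].

    A cycle of the reduction preserves the shape [C + f_l(j/2)]: if
    [l = 2^k (2l'+1)] then [f_l(j/2)] is, up to a constant,
    [f_(2l'+1)(j / 2^(k+1))], which is [2^(k+1)]-simple; subtracting [c] removes
    the factor [j+1], and [F] undoes the resulting shift, which leaves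
    [f_(2l')(j)], that is [f_l'(j/2)] up to a constant.  So a cycle outputs
    [k+1] and erases the lowest [k+1] binary digits of [l]. *)

(** * Valuations of rising factorials *)

Definition vrising (l t : nat) : nat := logn 2 (l + t)`! - logn 2 t`!.

Lemma vrisingE l t : vrising l t + logn 2 t`! = logn 2 (l + t)`!.
Proof.
rewrite /vrising subnK //; apply: dvdn_leq_log; first exact: fact_gt0.
elim: l => // l IH; rewrite addSn factS; exact: dvdn_mull.
Qed.

Lemma logn2_odd n : odd n -> logn 2 n = 0.
Proof. by move=> o; rewrite lognE dvdn2 o andbF. Qed.

Lemma logn2_double n : 0 < n -> logn 2 (2 * n) = (logn 2 n).+1.
Proof. by move=> n0; rewrite lognM // (@logn_prime 2 2). Qed.

Lemma logn2_fact_double n : logn 2 (2 * n)`! = n + logn 2 n`!.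
Proof.
elim: n => // n IH; rewrite mulnS add2n !factS !lognM ?muln_gt0 ?fact_gt0 //.
rewrite IH; have -> : (2 * n).+2 = 2 * n.+1 by lia.
rewrite logn2_double // (@logn2_odd (2 * n).+1) ?mul2n /= ?odd_double //; lia.
Qed.

Lemma logn2_fact_half n : logn 2 n`! = n./2 + logn 2 (n./2)`!.
Proof.
rewrite -logn2_fact_double -[in LHS](odd_double_half n) -mul2n.
case: (odd n); rewrite ?add0n // add1n factS lognM ?fact_gt0 //.
by rewrite logn2_odd ?mul2n /= ?odd_double.
Qed.

(** The odd factors of [(t+1) ... (t+2l)] contribute nothing; the even ones are twice
    [t./2 + 1, ..., t./2 + l]. *)
Lemma vrising_double l t : vrising (2 * l) t = l + vrising l t./2.
Proof.
have := vrisingE (2 * l) t; have := vrisingE l t./2.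
rewrite (logn2_fact_half t) (logn2_fact_half (2 * l + t)).
have -> : (2 * l + t)./2 = l + t./2 by rewrite halfD mul2n odd_double doubleK.
lia.
Qed.

Lemma vrising0 t : vrising 0 t = 0. Proof. by rewrite /vrising subnn. Qed.

Lemma vrisingS l t : vrising l.+1 t = vrising l t.+1 + logn 2 t.+1.
Proof.
have := vrisingE l.+1 t; have := vrisingE l t.+1.
by rewrite addnS addSn factS lognM ?fact_gt0 //; lia.
Qed.

(** The two products [1 ... o] and [2 ... (o+1)] differ by the factor [o+1], which is even. *)
Lemma vrising_odd_lt o : odd o -> vrising o 0 < vrising o 1.
Proof.
move=> oo; have := vrisingE o 0; have := vrisingE o 1.
rewrite addn1 addn0 [o.+1`!]factS lognM ?fact_gt0 //.
have e0 : logn 2 0`! = 0 by []; have e1 : logn 2 1`! = 0 by [].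
suff : 0 < logn 2 o.+1 by lia.
by rewrite logn_gt0 mem_primes /= dvdn2 /= oo.
Qed.

(** * One cycle of the reduction *)

Definition has_shape (C : int) (l : nat) (a : Defs.sequence) : Prop :=
  forall j, a j = (C + (vrising l j./2)%:Z)%R.

Lemma iterT n a j : iter n T a j = a (2 ^ n * j).
Proof.
elim: n a j => [|n IH] a j; first by rewrite mul1n.
by rewrite iterSr IH /T expnS mulnA.
Qed.

Lemma shape_pow2 C k o a : has_shape C (2 ^ k * o) a ->
  exists C', forall j, a j = (C' + (vrising o (j %/ 2 ^ k.+1))%:Z)%R.
Proof.
elim: k C o => [|k IH] C o sa.
  by exists C => j; rewrite sa mul1n divn2.
have [|C' eC'] := IH C (2 * o).
  by move=> j; rewrite sa expnSr mulnA.
exists (C' + o%:Z)%R => j; rewrite eC' vrising_double PoszD addrA.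
by rewrite -divn2 -divnMA -expnSr.
Qed.

(** A longer first block would contain the indices 0 and [2 ^ k.+1], where the values are
    [C' + vrising o 0] and [C' + vrising o 1]; these differ because [o] is odd. *)
Lemma shape_simple C k o a : odd o -> has_shape C (2 ^ k * o) a ->
  simple (2 ^ k.+1) a.
Proof.
move=> oo /shape_pow2[C' sa]; have p := expn_gt0 2 k.+1.
split=> [|t i lti|s bs]; first by rewrite expnS leq_pmulr ?expn_gt0.
  by rewrite !sa mulnC divnMDl // mulnK // (divn_small lti) addn0.
rewrite leqNgt; apply/negP => lts.
have := bs 0 _ lts; rewrite muln0 add0n !sa divnn p div0n => /addrI[].
by have := vrising_odd_lt oo; lia.
Qed.

Lemma shape_W C k l a : has_shape C (2 ^ k * (2 * l).+1) a ->
  exists C', has_shape C' l (W k.+1 a).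
Proof.
move=> /shape_pow2[C' sa]; exists (C' + l%:Z)%R => j.
rewrite /W /F iterT sa mulKn ?expn_gt0 // /Defs.c vrisingS vrising_double.
(* At [j = 0] the term repeated by [F] agrees with the shape because [1./2 = 0./2]. *)
by case: j => [|j] /=; lia.
Qed.

Lemma shape0_constant C a : has_shape C 0 a -> constant_seq a.
Proof. by move=> sa; exists C => j; rewrite sa vrising0 addr0. Qed.

Lemma oddpart_split l : 0 < l -> exists k l', l = 2 ^ k * (2 * l').+1.
Proof.
elim/ltn_ind: l => l IH l0; case: (boolP (odd l)) => ol.
  by exists 0, l./2; rewrite mul1n mul2n -{1}(odd_double_half l) ol.
have el : l = 2 * l./2 by lia.
have [||k [l' e]] := IH l./2; try lia.
by exists k.+1, l'; rewrite el e expnS mulnA.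
Qed.

(** A constant sequence has constant blocks of every length, so it is not simple. *)
Lemma shape_not_constant C l a : 0 < l -> has_shape C l a -> ~ constant_seq a.
Proof.
move=> /oddpart_split[k [l' ->]] sa [v av].
have oo : odd (2 * l').+1 by rewrite mul2n /= odd_double.
have [_ _ /(_ (2 ^ k.+1).+1)] := shape_simple oo sa; rewrite ltnn.
by move=> h; apply/notF/h => t i _; rewrite !av.
Qed.

Lemma simple_unique n n' a : simple (2 ^ n) a -> simple (2 ^ n') a -> n = n'.
Proof.
move=> [_ b m] [_ b' m']; apply/eqP.
by rewrite -(@eqn_exp2l 2) // eqn_leq m' // m.
Qed.

(** * Erasing the lowest binary digits, and the reduction sequence *)

Lemma binary_split k ks : sorted ltn (k :: ks) ->
  \sum_(i <- k :: ks) 2 ^ i =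
  2 ^ k * (2 * \sum_(i <- [seq i - k.+1 | i <- ks]) 2 ^ i).+1.
Proof.
move=> /= pk; rewrite big_cons big_map mulnS; congr (_ + _).
have kks : {in ks, forall i, k < i} by apply/allP; exact: order_path_min ltn_trans pk.
rewrite 2!big_distrr /= big_seq [in RHS]big_seq; apply: eq_bigr => i /kks lki.
by rewrite -!expnS -expnD; congr (2 ^ _); lia.
Qed.

Lemma sorted_shift k ks : sorted ltn (k :: ks) ->
  sorted ltn [seq i - k.+1 | i <- ks].
Proof.
move=> /= pk; have kks : all (ltn k) ks := order_path_min ltn_trans pk.
rewrite sorted_map; have := path_sorted pk.
apply: (sub_in_sorted _ kks) => i j; rewrite /= !inE /=; lia.
Qed.

(** The new first gap is [(k2 - k.+1).+1 = k2 - k]; later differences are invariant under the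
    shift. *)
Lemma gaps_shift k ks : sorted ltn (k :: ks) ->
  gaps (k :: ks) = k.+1 :: gaps [seq i - k.+1 | i <- ks].
Proof.
case: ks => //= k2 ks /andP[kk2 p].
have k2ks : all (leq k.+1) ks.
  by apply/allP => i /(allP (order_path_min ltn_trans p)) /=; lia.
congr [:: _ , _ & _]; first lia.
elim: ks k2 kk2 k2ks {p} => //= i ks IH k2 kk2 /andP[ki kks].
by rewrite -IH //; congr cons; lia.
Qed.

Lemma sum_pow2_gt0 ks : (0 < \sum_(i <- ks) 2 ^ i) = (ks != [::]).
Proof.
by case: ks => [|k ks]; rewrite ?big_nil // big_cons addn_gt0 expn_gt0.
Qed.

(** Induction on the number of binary ones: each cycle removes exactly one. The forward direction
    holds because the exponent of a cycle is unique and constancy of [W] decides which constructor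
    applies. *)
Lemma reduction_gaps C ks a ns : ks != [::] -> sorted ltn ks ->
  has_shape C (\sum_(k <- ks) 2 ^ k) a -> reduction a ns <-> ns = gaps ks.
Proof.
move En : (size ks) => n; elim: n C ks En a ns => [|n IH] C [|k ks] //= [sz].
move=> a ns _ srt; have ssh := sorted_shift srt.
rewrite binary_split // -/(gaps (k :: ks)) gaps_shift //.
set ks' := map _ _ in ssh * => sa.
have sz' : size ks' = n by rewrite size_map.
have oo : odd (2 * \sum_(i <- ks') 2 ^ i).+1 by rewrite mul2n /= odd_double.
have sim := shape_simple oo sa; have [C' sW] := shape_W sa.
have [e0|n0] := eqVneq ks' [::].
  have cW : constant_seq (W k.+1 a).
    by apply: (@shape0_constant C'); rewrite e0 big_nil in sW.
  rewrite e0; split=> [red|->]; last exact: reduction_stop.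
  case: red sim cW => [b n1 s1 _ s2 _|b n1 ns1 s1 nc _ s2]; rewrite -(simple_unique s1 s2) //.
have ncW : ~ constant_seq (W k.+1 a).
  by apply: (@shape_not_constant C' (\sum_(i <- ks') 2 ^ i)); rewrite ?sum_pow2_gt0.
have IHW ms := IH C' ks' sz' (W k.+1 a) ms n0 ssh sW.
split=> [red|->]; last by apply: reduction_next => //; apply/IHW.
case: red sim ncW IHW {sa sW} => [b n1 s1 cc s2|b n1 ns1 s1 nc red s2];
  rewrite -(simple_unique s1 s2) //.
by move=> _ /(_ ns1)[/(_ red)->].
Qed.

(** * Reading the composition off the binary digits *)

Lemma trunc_log2_double (b : bool) l : 0 < l -> trunc_log 2 (b + 2 * l) = (trunc_log 2 l).+1.
Proof.
move=> l0; rewrite trunc_log2S; last by case: b; lia.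
by congr (trunc_log 2 _).+1; rewrite mul2n half_bit_double.
Qed.

Lemma binary_digits_double (b : bool) l : 0 < l ->
  binary_digits (b + 2 * l) = b :: binary_digits l.
Proof.
move=> l0; rewrite /binary_digits trunc_log2_double //.
rewrite -[(trunc_log 2 l).+2]add1n iotaD [0 + 1]addnC map_cat iotaDl -map_comp.
rewrite -[RHS]cat1s; congr (_ ++ _).
  by rewrite /= divn1 mul2n oddD odd_double addbF oddb.
apply: eq_map => i /=.
by rewrite add1n expnS divnMA divn2 mul2n half_bit_double.
Qed.

(** The [k] trailing zeros only advance the counter [d]; the one after them closes a part and resets
    it. *)
Lemma read_binary_digits d k l :
  read_digits d (binary_digits (2 ^ k * (2 * l).+1)) =
  (d + k).+1 :: (if l == 0 then [::] else composition l).
Proof.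
elim: k d => [|k IH] d.
  rewrite mul1n addn0; case: (posnP l) => [->|l0] //.
  by rewrite -[(2 * l).+1]/(true + 2 * l) binary_digits_double //= /composition (gtn_eqF l0).
rewrite expnS -mulnA -[2 * (_ * _)]/(false + _) binary_digits_double.
  by rewrite -addSnnS; exact: IH.
by rewrite muln_gt0 expn_gt0.
Qed.

Lemma composition_gaps ks : ks != [::] -> sorted ltn ks ->
  composition (\sum_(k <- ks) 2 ^ k) = gaps ks.
Proof.
move En : (size ks) => n; elim: n ks En => [|n IH] [|k ks] //= [sz] _ srt.
have ssh := sorted_shift srt.
rewrite binary_split // -/(gaps (k :: ks)) gaps_shift // /composition read_binary_digits add0n.
set ks' := map _ _ in ssh *; congr cons.
rewrite -[_ == 0]negbK -lt0n sum_pow2_gt0 negbK.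
have [->|n0] //= := eqVneq ks' [::]; apply: IH => //; by rewrite size_map.
Qed.

(** * The coefficients of [P(x+1)] and their recurrence *)

Definition weight (m k : nat) : nat :=
  2 ^ k * 'C(2 * m - 2 * k, m - k) * 'C(m + k, m).

Definition shifted_coef (m l : nat) : nat :=
  \sum_(l <= k < m.+1) weight m k * 'C(k, l).

Lemma central_binS n :
  n.+1 * 'C(2 * n.+1, n.+1) = 2 * (2 * n).+1 * 'C(2 * n, n).
Proof.
have h1 := mul_bin_diag (2 * n).+2 n.
have h2 := mul_bin_diag (2 * n).+1 n.
have h3 : 'C((2 * n).+1, n) = 'C((2 * n).+1, n.+1).
  by rewrite -bin_sub; [congr 'C(_, _); lia | lia].
rewrite /= in h1 h2; have -> : 2 * n.+1 = (2 * n).+2 by lia.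
nia.
Qed.

Lemma weightS m k : k < m ->
  k.+1 * (2 * (m - k)).-1 * weight m k.+1 = (m - k) * (m + k.+1) * weight m k.
Proof.
move=> ltkm; rewrite /weight.
have [n en] : exists n, m - k = n.+1 by exists (m - k.+1); lia.
have -> : 2 * m - 2 * k.+1 = 2 * n by lia.
have -> : 2 * m - 2 * k = 2 * n.+1 by lia.
have -> : m - k.+1 = n by lia.
have -> : (2 * (m - k)).-1 = (2 * n).+1 by lia.
rewrite en; have h1 := central_binS n.
have h2 : k.+1 * 'C(m + k.+1, m) = (m + k.+1) * 'C(m + k, m).
  have e1 : 'C(m + k.+1, m) = 'C(m + k.+1, k.+1).
    by rewrite -(@bin_sub _ m) ?leq_addr // addKn.
  have e2 : 'C(m + k, m) = 'C(m + k, k).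
    by rewrite -(@bin_sub _ m) ?leq_addr // addKn.
  by rewrite e1 e2 -mul_bin_diag addnS.
rewrite expnS.
have -> : forall a b, k.+1 * (2 * n).+1 * (2 * 2 ^ k * a * b) =
  (2 * (2 * n).+1 * a) * (k.+1 * b) * 2 ^ k by move=> *; ring.
by rewrite -h1 h2; ring.
Qed.

Local Open Scope ring_scope.

(** Lets [ring] derive an identity from a known one by comparing the differences of their sides. *)
Lemma eq_of_subr (V : zmodType) (x y z t : V) : x = y -> z - t = x - y -> z = t.
Proof. by move=> -> /eqP; rewrite subrr subr_eq0 => /eqP. Qed.

Definition weight_poly (m : nat) : {poly int} := \poly_(k < m.+1) (weight m k)%:R.

Lemma weight_poly_ode m (P := weight_poly m) :
  'X * (2%:R - 'X) * P^`()^`() + (m * m.+1)%N%:R * P =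
  ((2 * m)%N%:R - 1 + 2%:R * 'X) * P^`().
Proof.
have rec k : k.+1%:R * (2%:R * (m%:R - k%:R) - 1) * P`_k.+1 =
             (m%:R - k%:R) * (m%:R + k.+1%:R) * P`_k.
  (* For [k > m] both coefficients vanish; for [k = m] so do the factor [m - k] and the coefficient
     of index [m+1]. *)
  rewrite !coef_poly !ltnS; have [ltkm|ltmk|->] := ltngtP k m; last first.
  - by rewrite subrr !mul0r mulr0.
  - by rewrite !mulr0.
  have -> : 2%:R * (m%:R - k%:R) - 1 = (2 * (m - k)).-1%:R :> int by lia.
  by rewrite -natrB 1?ltnW // -natrD -!natrM weightS.
clearbody P; apply/polyP => k.
rewrite !(mulrDl, mulrDr, mulNr, mulrN) -!mulrA.
rewrite !mulr_natl ?mul1r !(coefD, coefN, coefMn, coefXM, coef_deriv).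
case: k => [|[|k]] /=.
- by have := rec 0%N; move: P`_0 P`_1 => p q h; apply: (eq_of_subr (esym h)); ring.
- by have := rec 1%N; move: P`_1 P`_2 => p q h; apply: (eq_of_subr (esym h)); ring.
- by have := rec k.+2; move: P`_k.+2 P`_k.+3 => p q h;
    apply: (eq_of_subr (esym h)); ring.
Qed.

Definition shifted_poly m := weight_poly m \Po ('X + 1).

(** Translation commutes with derivation and turns [x (2 - x)] into [1 - x^2]; as this has no linear
    term, the recurrence for the coefficients has only three terms. *)
Lemma shifted_poly_ode m (Q := shifted_poly m) :
  (1 - 'X ^+ 2) * Q^`()^`() + (m * m.+1)%N%:R * Q =
  ((2 * m)%N%:R + 1 + 2%:R * 'X) * Q^`().
Proof.
have dQ (p : {poly int}) : (p \Po ('X + 1))^`() = p^`() \Po ('X + 1).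
  by rewrite deriv_comp derivD derivX -[1]/(1%:P) derivC addr0 mulr1.
rewrite /Q /shifted_poly !dQ.
have := congr1 (fun p => p \Po ('X + 1)) (weight_poly_ode m).
rewrite /= !(comp_polyM, comp_polyB, comp_polyD, rmorph_nat, comp_polyX).
rewrite (_ : 1 \Po _ = 1) ?comp_polyC //.
set Y2 := _^`()^`() \Po _; set Y1 := _^`() \Po _; set Y := weight_poly m \Po _.
clearbody Y2 Y1 Y.
move=> h; apply: (eq_of_subr h); ring.
Qed.

Lemma coef_X1n k l : (('X + 1) ^+ k : {poly int})`_l = 'C(k, l)%:R.
Proof.
rewrite exprD1n coef_sum; under eq_bigr do rewrite coefMn coefXn.
have [ltkl|lelk] := ltnP k l.
  rewrite bin_small // big1 // => i _; case: eqP => [eli|_]; last by rewrite mul0rn.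
  by have := ltn_ord i; rewrite -eli; lia.
rewrite (bigD1 (Ordinal (lelk : l < k.+1)%N)) //= eqxx big1 ?addr0 // => i ni.
by case: eqP => [eli|_]; rewrite ?mul0rn //; case/eqP: ni; apply/val_inj.
Qed.

Lemma coef_shifted_poly m l : (shifted_poly m)`_l = (shifted_coef m l)%:R.
Proof.
rewrite coef_comp_poly.
have sP : (size (weight_poly m) <= m.+1)%N by exact: size_poly.
rewrite (big_ord_widen _ (fun i => (weight_poly m)`_i * (('X + 1) ^+ i)`_l) sP).
rewrite big_mkcond /shifted_coef natr_sum /= -(big_mkord predT (fun i =>
  if (i < size (weight_poly m))%N then (weight_poly m)`_i * (('X + 1) ^+ i)`_l else 0)).
have e i : (i < m.+1)%N ->
    (if (i < size (weight_poly m))%N then (weight_poly m)`_i * (('X + 1) ^+ i)`_l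
     else 0) = (weight m i * 'C(i, l))%N%:R.
  move=> lti; rewrite natrM -coef_X1n.
  have -> : (weight m i)%:R = (weight_poly m)`_i by rewrite coef_poly lti.
  by case: ltnP => // h; rewrite nth_default ?mul0r.
rewrite (eq_big_nat _ _ (fun i h => e i (proj2 (andP h)))).
(* The terms with [i < l] vanish since ['C(i, l) = 0]. *)
have [ltml|lelm] := leqP l m.+1; last first.
  rewrite [RHS]big_geq 1?ltnW // big_nat big1 // => i /andP[_ lti].
  by rewrite bin_small ?muln0 //; lia.
rewrite (big_cat_nat (n := l)) //= [X in X + _]big_nat big1 ?add0r // => i /andP[_ lti].
by rewrite bin_small ?muln0.
Qed.

Lemma shifted_coef_rec m l : 
  (m%:R - l%:R) * (m%:R + l.+1%:R) * (shifted_coef m l)%:R =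
  (2 * m).+1%:R * l.+1%:R * (shifted_coef m l.+1)%:R
   - l.+1%:R * l.+2%:R * (shifted_coef m l.+2)%:R :> int.
Proof.
rewrite -!coef_shifted_poly.
have := congr1 (fun p : {poly int} => p`_l) (shifted_poly_ode m).
move: (shifted_poly m) => Q.
rewrite !(mulrDl, mulrDr, mulNr, mulrN) expr2 -!mulrA ?mul1r !mulr_natl.
rewrite !(coefD, coefN, coefMn, coefXM, coef_deriv).
case: l => [|[|l]] /=.
- by move: Q`_0 Q`_1 Q`_2 => p q r h; apply: (eq_of_subr h); ring.
- by move: Q`_1 Q`_2 Q`_3 => p q r h; apply: (eq_of_subr h); ring.
- by move: Q`_l.+2 Q`_l.+3 Q`_l.+4 => p q r h; apply: (eq_of_subr h); ring.
Qed.

(** * Oddness of the normalized coefficients *)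

Lemma shifted_coef_diag m : shifted_coef m m = (2 ^ m * 'C(2 * m, m))%N.
Proof.
rewrite /shifted_coef big_nat1 /weight subnn binn muln1.
by rewrite subnn bin0 muln1 addnn -mul2n.
Qed.

(* The odd number 2 b + 1 is A l m / (2^l (m+l)! / (m-l)!); its oddness
   propagates down in l because (m - l) (m + l + 1) is even. *)
Lemma shifted_coef_odd m l : (l <= m)%N ->
  exists b : int, (l`! * m`! * (m - l)`! * shifted_coef m l)%N%:R =
    (2 * b + 1) * (2 ^ m * (m + l)`!)%N%:R.
Proof.
move=> lelm; move: {2}(m - l)%N (leqnn (m - l)) => d.
elim/ltn_ind: d l lelm => d IH l lelm led.
have [elm|ltlm] := eqVneq l m.
  exists 0; rewrite mulr0 add0r mul1r elm shifted_coef_diag subnn fact0 muln1.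
  have := bin_fact (leq_addr m m); rewrite addKn addnn -mul2n => <-.
  by congr (_%:R); ring.
have [||b1 h1] := IH (m - l.+1)%N _ l.+1 _ (leqnn _); try lia.
have [n en] : exists n, (m - l = n.+1)%N by exists (m - l.+1)%N; lia.
have em : (m - l.+1 = n)%N by lia.
have eml : m%:R - l%:R = n.+1%:R :> int by lia.
(* The factor [n] comes from [n! = n (n-1)!]; for [n = 0] both sides are 0, so any [b2] serves. *)
have [b2 h2] : exists b2 : int,
    (l.+2`! * m`! * n`! * shifted_coef m l.+2)%N%:R =
    n%:R * (2 * b2 + 1) * (2 ^ m * (m + l.+2)`!)%N%:R.
  have [n0|n0] := posnP n.
    exists 0; rewrite n0 !mul0r /shifted_coef big_geq ?muln0 //; lia.
  have [||b2 h2] := IH (m - l.+2)%N _ l.+2 _ (leqnn _); try lia.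
  exists b2; rewrite -mulrA -h2 -natrM; congr (_%:R).
  have -> : n = (m - l.+2).+1 by lia.
  by rewrite [(m - l.+2).+1`!]factS; ring.
have := shifted_coef_rec m l; rewrite eml.
rewrite em in h1.
(* Since [n = m - l - 1], the factors [n] and [m+l+2] add up to [2m+1], so one of them is even. *)
have [c ec] : exists c : int, n%:R * (m + l.+2)%N%:R = 2 * c.
  have : ~~ odd (n * (m + l.+2)) by rewrite oddM !oddD /=; lia.
  move=> o; exists (n * (m + l.+2))./2%:R; lia.
move=> rec.
(* Solves [2b + 1 = (2m+1)(2 b1 + 1) - 2c (2 b2 + 1)], the recurrence for [B(l)]. *)
exists (m%:R + b1 * (2 * m).+1%:R - c * (2 * b2 + 1)).
have nz : ((m + l.+1)%N%:R : int) != 0 by lia.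
apply: (mulfI nz).
have f1 : (m + l.+1)`! = ((m + l.+1) * (m + l)`!)%N by rewrite addnS factS.
have f2 : (m + l.+2)`! = ((m + l.+2) * ((m + l.+1) * (m + l)`!))%N.
  by rewrite -f1 addnS factS.
have e1 : ((m + l.+1)%N%:R : int) * (l`! * m`! * (m - l)`! * shifted_coef m l)%N%:R =
  (l`! * m`! * n`!)%N%:R * (n.+1%:R * (m%:R + l.+1%:R) * (shifted_coef m l)%:R).
  rewrite en factS; rewrite !natrM natrD; ring.
have e2 : (l`! * m`! * n`!)%N%:R *
  ((2 * m).+1%:R * l.+1%:R * (shifted_coef m l.+1)%:R
   - l.+1%:R * l.+2%:R * (shifted_coef m l.+2)%:R) =
  (2 * m).+1%:R * (l.+1`! * m`! * n`! * shifted_coef m l.+1)%N%:R -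
  (l.+2`! * m`! * n`! * shifted_coef m l.+2)%N%:R :> int.
  rewrite !factS; rewrite !natrM; ring.
rewrite e1 rec e2 h1 h2 f1 f2.
rewrite !natrM.
move: ec; rewrite natrD; move: (2 ^ m)%N%:R ((m + l)`!)%:R (m + l.+1)%N%:R => x y z.
move=> h; have -> : n%:R * (2 * b2 + 1) * (x * ((m%:R + l.+2%:R) * (z * y))) =
  (n%:R * (m%:R + l.+2%:R)) * ((2 * b2 + 1) * x * z * y) by ring.
by rewrite h -[(2 * m).+1]addn1 natrD natrM; ring.
Qed.

(** * The valuation of [A l m] *)

Lemma logn_shifted_coef m l : (l <= m)%N ->
  logn 2 (l`! * m`! * (m - l)`! * shifted_coef m l) = (m + logn 2 (m + l)`!)%N.
Proof.
move=> /shifted_coef_odd[b /(congr1 absz)]; rewrite abszM !natz /= => ->.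
have o : odd `|2 * b + 1| by lia.
rewrite !lognM ?muln_gt0 ?expn_gt0 ?fact_gt0 ?(odd_gt0 o) //.
by rewrite logn2_odd // lognX (@logn_prime 2 2) // muln1.
Qed.

Lemma shifted_coef_gt0 m l : (l <= m)%N -> (0 < shifted_coef m l)%N.
Proof.
move=> lelm; rewrite /shifted_coef big_nat_recr //= ltn_addl //.
by rewrite /weight !muln_gt0 expn_gt0 !bin_gt0 lelm leq_addr subnn.
Qed.

(** Cross-multiplication with the reduced form: [nu2] may be computed on any fraction. *)
Lemma nu2_frac p q : (0 < p)%N -> (0 < q)%N ->
  nu2 (p%:R / q%:R) = (logn 2 p)%:Z - (logn 2 q)%:Z.
Proof.
move=> p0 q0; set x := p%:R / q%:R : rat; rewrite /nu2.
have x0 : x != 0 by rewrite mulf_neq0 ?invr_eq0 ?pnatr_eq0 -?lt0n.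
have nx0 : (0 < `|numq x|)%N by rewrite absz_gt0 numq_eq0.
have dx0 : (0 < `|denq x|)%N by rewrite absz_gt0 denq_neq0.
have e : (`|numq x| * q = p * `|denq x|)%N.
  have : (numq x * q%:Z)%:~R = (p%:Z * denq x)%:~R :> rat.
    rewrite !intrM numqE /x -!pmulrn mulrAC mulfVK ?pnatr_eq0 -?lt0n //.
  by move/intr_inj/(congr1 absz); rewrite !abszM !absz_nat.
have := congr1 (logn 2) e; rewrite !lognM //; lia.
Qed.

(** With [m = l + j], the numerator of [A l m] has valuation [l + j + v((2l+j)!) - v(j!)], and the
    denominator [2 ^ (m - l)] takes away [j]. *)
Lemma X_eq_valuation l j : X l j = l%:Z + (vrising (2 * l) j)%:Z.
Proof.
rewrite /X /A addKn.
have -> : (\sum_(l <= k < (l + j).+1) 2 ^ k * 'C(2 * (l + j) - 2 * k, l + j - k) *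
  'C(l + j + k, l + j) * 'C(k, l))%N = shifted_coef (l + j) l by [].
have s0 := shifted_coef_gt0 (leq_addr j l).
rewrite mulrAC -natrM -natrX nu2_frac ?muln_gt0 ?fact_gt0 ?expn_gt0 //.
have := logn_shifted_coef (leq_addr j l); have := vrisingE (2 * l) j.
have -> : (l + j + l = 2 * l + j)%N by lia.
rewrite addKn !lognM ?muln_gt0 ?fact_gt0 // lognX (@logn_prime 2 2) // muln1; lia.
Qed.

Local Close Scope ring_scope.

Theorem theorem5p4 (l : nat) (ks : seq nat)
    (l_ge1 : 1 <= l)
    (ks_increasing : sorted ltn ks)
    (l_binary : l = \sum_(k <- ks) 2 ^ k) :
  (forall ns : seq nat, is_Omega l ns <-> ns = gaps ks) /\
  (forall ns : seq nat, is_Omega l ns <-> ns = composition l).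
Proof.
have n0 : ks != [::] by rewrite -sum_pow2_gt0 -l_binary.
have -> : composition l = gaps ks by rewrite l_binary composition_gaps.
(* One [l] is the constant in [X_eq_valuation], the other comes from halving [vrising (2 * l) j]. *)
have sX : has_shape (l + l)%:Z (\sum_(k <- ks) 2 ^ k) (X l).
  by move=> j; rewrite -l_binary X_eq_valuation vrising_double !PoszD addrA.
by split=> ns; apply: reduction_gaps n0 ks_increasing sX.
Qed.
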